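(* For $(i,j)\in\mathbb Z^2$, the biorthogonal test function associated to the average in cell $(i,j)$ of the two-dimensional Active Flux method with $K=2$ is $$\psi_{ij}(x,y)=\frac1{\Delta x\,\Delta y}\,\mathbb 1_{C_{ij}}(x,y).$$ That is, for all $(i,j),(i',j')\in\mathbb Z^2$, $$(\psi_{ij},\phi_{i',j'})_{L^2}=\delta_{i,i'}\delta_{j,j'},\qquad(\psi_{ij},\phi_{i'+\frac12,j'})_{L^2}=(\psi_{ij},\phi_{i',j'+\frac12})_{L^2}=(\psi_{ij},\phi_{i'+\frac12,j'+\frac12})_{L^2}=0,$$ where the $\phi$'s are the global two-dimensional Active Flux basis functions.
   Context: Grid: $\Delta x,\Delta y>0$; $x_{i+\frac12}-x_{i-\frac12}=\Delta x$, $y_{j+\frac12}-y_{j-\frac12}=\Delta y$; $C_{ij}=[x_{i-\frac12},x_{i+\frac12})\times[y_{j-\frac12},y_{j+\frac12})$ with centre $(x_i,y_j)$. $\mathbb 1_I$ is the characteristic function of $I$, and $(u,v)_{L^2}=\iint_{\mathbb R^2}uv\,\mathrm dx\,\mathrm dy$. Local basis functions on $C=[-\frac{\Delta x}2,\frac{\Delta x}2]\times[-\frac{\Delta y}2,\frac{\Delta y}2]$, with $\xi=x/\Delta x$, $\eta=y/\Delta y$ (biparabolic polynomials associated to the cell average, the four edge midpoint values and the four node values): $$B_{+\frac12,+\frac12}=\tfrac1{16}(2\xi+1)(2\eta+1)(-1+2\eta+2\xi+12\xi\eta),\quad B_{-\frac12,+\frac12}=\tfrac1{16}(2\xi-1)(2\eta+1)(1-2\eta+2\xi+12\xi\eta),$$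 $$B_{-\frac12,-\frac12}=\tfrac1{16}(2\xi-1)(2\eta-1)(-1-2\eta-2\xi+12\xi\eta),\quad B_{+\frac12,-\frac12}=\tfrac1{16}(2\xi+1)(2\eta-1)(1+2\eta-2\xi+12\xi\eta),$$ $$B_{0,+\frac12}=-\tfrac14(4\xi^2-1)(2\eta+1)(6\eta-1),\quad B_{0,-\frac12}=-\tfrac14(4\xi^2-1)(2\eta-1)(6\eta+1),$$ $$B_{-\frac12,0}=-\tfrac14(2\xi-1)(6\xi+1)(4\eta^2-1),\quad B_{+\frac12,0}=-\tfrac14(2\xi+1)(6\xi-1)(4\eta^2-1),$$ $$B_0=\tfrac94(4\xi^2-1)(4\eta^2-1).$$ Global basis functions: $$\phi_{ij}(x,y)=B_0(x-x_i,y-y_j)\mathbb 1_{C_{ij}},$$ $$\phi_{i+\frac12,j}(x,y)=B_{+\frac12,0}(x-x_i,y-y_j)\mathbb 1_{C_{ij}}+B_{-\frac12,0}(x-x_{i+1},y-y_j)\mathbb 1_{C_{i+1,j}},$$ $$\phi_{i,j+\frac12}(x,y)=B_{0,+\frac12}(x-x_i,y-y_j)\mathbb 1_{C_{ij}}+B_{0,-\frac12}(x-x_i,y-y_{j+1})\mathbb 1_{C_{i,j+1}},$$ $$\phi_{i+\frac12,j+\frac12}(x,y)=B_{+\frac12,+\frac12}(x-x_i,y-y_j)\mathbb 1_{C_{ij}}+B_{+\frac12,-\frac12}(x-x_i,y-y_{j+1})\mathbb 1_{C_{i,j+1}}+B_{-\frac12,+\frac12}(x-x_{i+1},y-y_j)\mathbb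 1_{C_{i+1,j}}+B_{-\frac12,-\frac12}(x-x_{i+1},y-y_{j+1})\mathbb 1_{C_{i+1,j+1}}.$$ *)

(* Defs.v *)
From HB Require Import structures.
From mathcomp Require Import all_boot all_order all_algebra.
From mathcomp Require Import all_classical all_reals all_analysis.

Set Implicit Arguments.
Unset Strict Implicit.
Unset Printing Implicit Defensive.

Import Order.TTheory GRing.Theory Num.Theory.

Local Open Scope classical_set_scope.
Local Open Scope ring_scope.

(* Extended-real valued: the value is a real number only when the positive and
   negative parts of u * v both have finite integral. *)
Definition L2_inner (R : realType) (u v : R -> R -> R) : \bar R :=
  (\int[(@lebesgue_measure R \x @lebesgue_measure R)%E]_z
     (u z.1 z.2 * v z.1 z.2)%:E)%E.

(* The letters p, m, 0 in B_st stand for +1/2, -1/2, 0.  The polynomials are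
   defined on all of R^2; below they only occur multiplied by the
   characteristic function of a cell. *)
Section LocalBasis.
Variables (R : realType) (dx dy : R).
Implicit Types x y : R.

Definition B_pp x y : R := let xi := x / dx in let eta := y / dy in
  1 / 16 * (2 * xi + 1) * (2 * eta + 1)
    * (- 1 + 2 * eta + 2 * xi + 12 * xi * eta).

Definition B_mp x y : R := let xi := x / dx in let eta := y / dy in
  1 / 16 * (2 * xi - 1) * (2 * eta + 1)
    * (1 - 2 * eta + 2 * xi + 12 * xi * eta).

Definition B_mm x y : R := let xi := x / dx in let eta := y / dy in
  1 / 16 * (2 * xi - 1) * (2 * eta - 1)
    * (- 1 - 2 * eta - 2 * xi + 12 * xi * eta).

Definition B_pm x y : R := let xi := x / dx in let eta := y / dy in
  1 / 16 * (2 * xi + 1) * (2 * eta - 1)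
    * (1 + 2 * eta - 2 * xi + 12 * xi * eta).

Definition B_0p x y : R := let xi := x / dx in let eta := y / dy in
  - (1 / 4) * (4 * xi ^+ 2 - 1) * (2 * eta + 1) * (6 * eta - 1).

Definition B_0m x y : R := let xi := x / dx in let eta := y / dy in
  - (1 / 4) * (4 * xi ^+ 2 - 1) * (2 * eta - 1) * (6 * eta + 1).

Definition B_m0 x y : R := let xi := x / dx in let eta := y / dy in
  - (1 / 4) * (2 * xi - 1) * (6 * xi + 1) * (4 * eta ^+ 2 - 1).

Definition B_p0 x y : R := let xi := x / dx in let eta := y / dy in
  - (1 / 4) * (2 * xi + 1) * (6 * xi - 1) * (4 * eta ^+ 2 - 1).

Definition B_00 x y : R := let xi := x / dx in let eta := y / dy in
  9 / 4 * (4 * xi ^+ 2 - 1) * (4 * eta ^+ 2 - 1).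

End LocalBasis.

(* [xh i] is the interface x_{i+1/2}; hence x_{i-1/2} is [xh (i - 1)]. *)
Definition uniform_grid (R : realType) (dx : R) (xh : int -> R) : Prop :=
  forall i : int, xh i - xh (i - 1) = dx.

Definition midpoint (R : realType) (xh : int -> R) (i : int) : R :=
  (xh (i - 1) + xh i) / 2.

Definition cell (R : realType) (xh yh : int -> R) (i j : int) : set (R * R) :=
  `[xh (i - 1), xh i[%classic `*` `[yh (j - 1), yh j[%classic.

Section GlobalFunctions.
Variables (R : realType) (dx dy : R) (xh yh : int -> R).
Implicit Types (i j : int) (x y : R).

Local Notation xc := (midpoint xh).
Local Notation yc := (midpoint yh).
Local Notation "''1_C' ( i , j )" := (\1_(cell xh yh i j) : R * R -> R).

Definition phi_avg i j x y : R :=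
  B_00 dx dy (x - xc i) (y - yc j) * '1_C(i, j) (x, y).

(* phi_{i+1/2,j} *)
Definition phi_xedge i j x y : R :=
  B_p0 dx dy (x - xc i) (y - yc j) * '1_C(i, j) (x, y)
  + B_m0 dx dy (x - xc (i + 1)) (y - yc j) * '1_C(i + 1, j) (x, y).

(* phi_{i,j+1/2} *)
Definition phi_yedge i j x y : R :=
  B_0p dx dy (x - xc i) (y - yc j) * '1_C(i, j) (x, y)
  + B_0m dx dy (x - xc i) (y - yc (j + 1)) * '1_C(i, j + 1) (x, y).

(* phi_{i+1/2,j+1/2} *)
Definition phi_node i j x y : R :=
  B_pp dx dy (x - xc i) (y - yc j) * '1_C(i, j) (x, y)
  + B_pm dx dy (x - xc i) (y - yc (j + 1)) * '1_C(i, j + 1) (x, y)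
  + B_mp dx dy (x - xc (i + 1)) (y - yc j) * '1_C(i + 1, j) (x, y)
  + B_mm dx dy (x - xc (i + 1)) (y - yc (j + 1)) * '1_C(i + 1, j + 1) (x, y).

Definition psi_avg i j x y : R := 1 / (dx * dy) * '1_C(i, j) (x, y).

End GlobalFunctions.

(* Main.v *)
Require Import Defs.
From mathcomp Require Import all_boot all_order all_algebra.
From mathcomp Require Import all_classical all_reals all_analysis.
From mathcomp Require Import measurable_realfun zify ring lra.
Import Order.TTheory GRing.Theory Num.Theory.
Import numFieldNormedType.Exports.
Set Implicit Arguments.
Unset Strict Implicit.
Unset Printing Implicit Defensive.
Local Open Scope ring_scope.
Local Open Scope classical_set_scope.

(** The test function psi_ij is the normalised characteristic function of the
cell C_ij, and distinct cells are disjoint ([indic_cellM]).  Hence pairing it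
with a global basis function keeps only the piece of that function supported
on C_ij, if there is one, and returns the mean value over the cell of the
local polynomial B of that piece ([pairing_local]).  The theorem is therefore
the statement that B_0 has mean 1 and that the eight point-value polynomials
have mean 0.

Each local polynomial is a product, or for the nodes a sum of two products, of
a quadratic in xi and a quadratic in eta.  By Fubini the integral of a product
factorises ([integral_tensorX]); by the fundamental theorem of calculus the
quadratic a0 + a1 xi + a2 xi^2 has mean a0 + a2 / 12 over -1/2 <= xi < 1/2
([integral_quad]).  What remains is arithmetic on the coefficients. *)

(** * Integrals of products f(x) g(y) *)

Section Tensor.
Context {d1 d2 : measure_display} {T1 : measurableType d1}
  {T2 : measurableType d2} {R : realType}.
Variables (m1 : {sigma_finite_measure set T1 -> \bar R})
  (m2 : {sigma_finite_measure set T2 -> \bar R}).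

Lemma integrable_tensor (f : T1 -> R) (g : T2 -> R) :
  m1.-integrable setT (EFin \o f) -> m2.-integrable setT (EFin \o g) ->
  (m1 \x m2)%E.-integrable setT (fun z => (f z.1 * g z.2)%:E).
Proof.
move=> /[dup] intf /integrableP[/measurable_EFinP mf foo].
move=> /[dup] intg /integrableP[/measurable_EFinP mg goo].
apply/integrable12ltyP.
  apply/measurable_EFinP; apply: measurable_funM.
  - exact: measurableT_comp.
  - exact: measurableT_comp.
have fin d (T : measurableType d) (m : {measure set T -> \bar R}) (h : T -> R) :
    m.-integrable setT (EFin \o h) -> (\int[m]_x `|h x|%:E)%E \is a fin_num.
  by move=> inth; apply: integrable_fin_num => //; exact: integrable_abse inth.
rewrite (eq_integral (fun x => (`|f x|%:E * \int[m2]_y `|g y|%:E)%E));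
  last first.
  move=> x _; rewrite -ge0_integralZl//=; last first.
    exact/measurable_EFinP/measurableT_comp.
  by apply: eq_integral => y _; rewrite normrM EFinM.
rewrite ge0_integralZr//=; [|exact/measurable_EFinP/measurableT_comp|].
- rewrite -(fineK (fin _ _ _ _ intf)) -(fineK (fin _ _ _ _ intg)) -EFinM.
  exact: ltry.
- by apply: integral_ge0 => y _; rewrite lee_fin.
Qed.

Lemma integral_tensor (f : T1 -> R) (g : T2 -> R) :
  m1.-integrable setT (EFin \o f) -> m2.-integrable setT (EFin \o g) ->
  (\int[m1 \x m2]_z (f z.1 * g z.2)%:E
    = (\int[m1]_x (f x)%:E) * \int[m2]_y (g y)%:E)%E.
Proof.
move=> intf intg.
rewrite -integral12_prod_meas1/=; last exact: integrable_tensor.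
rewrite (eq_integral (fun x => ((f x)%:E * \int[m2]_y (g y)%:E)%E)); last first.
  by move=> x _; rewrite -integralZl.
have /fineK <- : (\int[m2]_y (g y)%:E)%E \is a fin_num.
  exact: (integrable_fin_num _ intg).
by rewrite integralZr.
Qed.

Let tensor_restrict (A : set T1) (B : set T2) (f : T1 -> R) (g : T2 -> R) :
  (fun z => (f z.1 * g z.2)%:E : \bar R) \_ (A `*` B)
  = (fun z => ((f \_ A) z.1 * (g \_ B) z.2)%:E).
Proof.
apply/funext => -[x y]; rewrite /patch /= in_setX/=.
by case: (x \in A); case: (y \in B); rewrite ?mul0r ?mulr0.
Qed.

Let restrict_integrable d (T : measurableType d)
    (m : {measure set T -> \bar R}) (A : set T) (f : T -> R) :
  measurable A -> m.-integrable A (EFin \o f) ->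
  m.-integrable setT (EFin \o (f \_ A)).
Proof. by move=> mA /(integrable_mkcond _ mA); rewrite restrict_EFin. Qed.

(** The same two facts with the factors integrated over sets A and B. *)
Lemma integrable_tensorX (A : set T1) (B : set T2) (f : T1 -> R) (g : T2 -> R) :
  measurable A -> measurable B ->
  m1.-integrable A (EFin \o f) -> m2.-integrable B (EFin \o g) ->
  (m1 \x m2)%E.-integrable (A `*` B) (fun z => (f z.1 * g z.2)%:E).
Proof.
move=> mA mB intf intg; apply/(integrable_mkcond _ (measurableX mA mB)).
rewrite tensor_restrict.
by apply: integrable_tensor; exact: restrict_integrable.
Qed.

Lemma integral_tensorX (A : set T1) (B : set T2) (f : T1 -> R) (g : T2 -> R) :
  measurable A -> measurable B ->
  m1.-integrable A (EFin \o f) -> m2.-integrable B (EFin \o g) ->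
  (\int[m1 \x m2]_(z in A `*` B) (f z.1 * g z.2)%:E
    = (\int[m1]_(x in A) (f x)%:E) * \int[m2]_(y in B) (g y)%:E)%E.
Proof.
move=> mA mB intf intg; rewrite integral_mkcond tensor_restrict.
rewrite integral_tensor; [|exact: restrict_integrable..].
congr (_ * _)%E; rewrite [RHS]integral_mkcond; apply: eq_integral => t _.
- by rewrite /patch; case: ifP.
- by rewrite /patch; case: ifP.
Qed.

End Tensor.

(** * Mean value of a quadratic *)

Section Quadratic.
Context {R : realType}.
Local Notation mu := (@lebesgue_measure R).

Lemma integrable_horner (p : {poly R}) (a b : R) :
  mu.-integrable `[a, b[ (EFin \o horner p).
Proof.
apply: (@integrableS _ _ _ mu `[a, b]) => //.
  by apply: subset_itvl; rewrite bnd_simp.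
apply: continuous_compact_integrable; first exact: segment_compact.
exact/continuous_subspaceT/continuous_horner.
Qed.

Lemma integral_deriv_horner (P : {poly R}) (a b : R) : a < b ->
  (\int[mu]_(x in `[a, b[) (P^`().[x])%:E = (P.[b] - P.[a])%:E)%E.
Proof.
move=> ab.
have mP : measurable_fun `[a, b[ (horner P^`()).
  by apply: measurable_funTS; apply: continuous_measurable_fun;
    exact: continuous_horner.
rewrite integral_itv_bndo_bndc; last exact/measurable_EFinP.
rewrite (@continuous_FTC2 _ (horner P^`()) (horner P) _ _ ab) ?EFinB//.
- by apply: continuous_subspaceT; exact: continuous_horner.
- split=> [x _||]; first exact: derivable_horner.
  + by apply: cvg_at_right_filter; exact: continuous_horner.
  + by apply: cvg_at_left_filter; exact: continuous_horner.
- by move=> x _; rewrite derivE.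
Qed.

(** The quadratic a0 + a1 xi + a2 xi^2 in the scaled variable xi = t / h. *)
Definition quad (h a0 a1 a2 t : R) : R :=
  a0 + a1 * (t / h) + a2 * (t / h) ^+ 2.

(* A primitive of [x |-> quad h a0 a1 a2 (x - m)], as a polynomial in x. *)
Let quad_prim (h m a0 a1 a2 : R) : {poly R} :=
  let t := h^-1 *: ('X - m%:P) in
  h *: (a0 *: t + (a1 / 2) *: t ^+ 2 + (a2 / 3) *: t ^+ 3).

Let quadE (h m a0 a1 a2 x : R) : h != 0 ->
  quad h a0 a1 a2 (x - m) = (quad_prim h m a0 a1 a2)^`().[x].
Proof.
move=> h0; rewrite /quad /quad_prim !poly.derivE /= !hornerE /=.
by field.
Qed.

Lemma integrable_quad (h m a0 a1 a2 : R) : 0 < h ->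
  mu.-integrable `[m - h / 2, m + h / 2[
    (EFin \o (fun x => quad h a0 a1 a2 (x - m))).
Proof.
move=> h0; rewrite (_ : _ \o _ =
  EFin \o horner (quad_prim h m a0 a1 a2)^`()); first exact: integrable_horner.
by apply/funext => x; rewrite /= quadE ?gt_eqF.
Qed.

(** The linear term is odd about the midpoint m and drops out; the second moment
of xi over an interval of length 1 centred at 0 is 1 / 12. *)
Lemma integral_quad (h m a0 a1 a2 : R) : 0 < h ->
  (\int[mu]_(x in `[(m - h / 2)%R, (m + h / 2)%R[)
     (quad h a0 a1 a2 (x - m)%R)%:E = (h * (a0 + a2 / 12))%:E)%E.
Proof.
move=> h0; under eq_integral do rewrite quadE ?gt_eqF//.
rewrite integral_deriv_horner; last by lra.
congr EFin; rewrite /quad_prim !hornerE /=.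
by field; rewrite gt_eqF.
Qed.

End Quadratic.

(** * Mean values of the local basis functions *)

Section CellMean.
Context {R : realType} (dx dy : R).
Hypotheses (dx_gt0 : 0 < dx) (dy_gt0 : 0 < dy).
Local Notation mu := (@lebesgue_measure R).
Local Notation mu2 := (mu \x mu)%E.

Let box (m n : R) : set (R * R) :=
  `[m - dx / 2, m + dx / 2[%classic `*` `[n - dy / 2, n + dy / 2[%classic.

(** [B], placed at the centre of a dx by dy cell, is integrable there and has
mean value [v].  The property is required for every centre (m, n), so that no
translation invariance of the product measure is needed to use it. *)
Definition cell_mean (B : R -> R -> R) (v : R) : Prop :=
  forall m n : R,
    mu2.-integrable (box m n) (fun z => (B (z.1 - m) (z.2 - n))%:E) /\
    (\int[mu2]_(z in box m n) (B (z.1 - m)%R (z.2 - n)%R)%:E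
      = (dx * dy * v)%:E)%E.

Lemma cell_mean_quad (a0 a1 a2 b0 b1 b2 : R) :
  cell_mean (fun x y => quad dx a0 a1 a2 x * quad dy b0 b1 b2 y)
    ((a0 + a2 / 12) * (b0 + b2 / 12)).
Proof.
move=> m n.
have intx := @integrable_quad R dx m a0 a1 a2 dx_gt0.
have inty := @integrable_quad _ dy n b0 b1 b2 dy_gt0.
split.
  by apply: (integrable_tensorX (m1 := mu) (m2 := mu) _ _ intx inty).
rewrite (integral_tensorX (m1 := mu) (m2 := mu) _ _ intx inty)//.
rewrite !integral_quad// -EFinM; congr EFin; ring.
Qed.

Lemma cell_meanD (B1 B2 : R -> R -> R) (v1 v2 : R) :
  cell_mean B1 v1 -> cell_mean B2 v2 ->
  cell_mean (fun x y => B1 x y + B2 x y) (v1 + v2).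
Proof.
move=> mean1 mean2 m n; have [int1 e1] := mean1 m n.
have [int2 e2] := mean2 m n.
(* The type is given so that measurability refers to the sigma-algebra on which
   Lebesgue measure is defined. *)
have mbox : measurable (box m n : set (measurableTypeR R * measurableTypeR R)).
  exact: measurableX.
split; first exact: (integrableD mbox int1 int2).
under eq_integral do rewrite EFinD.
by rewrite integralD// e1 e2 -EFinD -mulrDr.
Qed.

Lemma eq_cell_mean (B B' : R -> R -> R) (v v' : R) :
  cell_mean B v -> (forall x y, B' x y = B x y) -> v' = v -> cell_mean B' v'.
Proof.
move=> mean eB ->; suff -> : B' = B by [].
by apply/funext => x; apply/funext => y.
Qed.

Let dx_neq0 : dx != 0. Proof. exact: lt0r_neq0. Qed.
Let dy_neq0 : dy != 0. Proof. exact: lt0r_neq0. Qed.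

Lemma cell_mean_B_00 : cell_mean (B_00 dx dy) 1.
Proof.
apply: (eq_cell_mean (cell_mean_quad (- 9 / 4) 0 9 (- 1) 0 4)) => [x y|].
  by rewrite /B_00 /quad; field; rewrite dx_neq0 dy_neq0.
by field.
Qed.

Lemma cell_mean_B_p0 : cell_mean (B_p0 dx dy) 0.
Proof.
apply: (eq_cell_mean (cell_mean_quad (1 / 4) (- 1) (- 3) (- 1) 0 4)) => [x y|].
  by rewrite /B_p0 /quad; field; rewrite dx_neq0 dy_neq0.
by field.
Qed.

Lemma cell_mean_B_m0 : cell_mean (B_m0 dx dy) 0.
Proof.
apply: (eq_cell_mean (cell_mean_quad (1 / 4) 1 (- 3) (- 1) 0 4)) => [x y|].
  by rewrite /B_m0 /quad; field; rewrite dx_neq0 dy_neq0.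
by field.
Qed.

Lemma cell_mean_B_0p : cell_mean (B_0p dx dy) 0.
Proof.
apply: (eq_cell_mean (cell_mean_quad (- 1) 0 4 (1 / 4) (- 1) (- 3))) => [x y|].
  by rewrite /B_0p /quad; field; rewrite dx_neq0 dy_neq0.
by field.
Qed.

Lemma cell_mean_B_0m : cell_mean (B_0m dx dy) 0.
Proof.
apply: (eq_cell_mean (cell_mean_quad (- 1) 0 4 (1 / 4) 1 (- 3))) => [x y|].
  by rewrite /B_0m /quad; field; rewrite dx_neq0 dy_neq0.
by field.
Qed.

(** The four node polynomials at once: s and t are the signs of the corner.
Since s^2 = t^2 = 1, the polynomial equals
(4 xi^2 - 1) (2 t eta + 1) / 16
+ (12 xi^2 + 8 s xi + 1) (4 eta^2 + 2 t eta) / 16,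
and the two summands have means -1/24 and 1/24. *)
Lemma cell_mean_B_node (s t : R) : s ^+ 2 = 1 -> t ^+ 2 = 1 ->
  cell_mean (fun x y => let xi := x / dx in let eta := y / dy in
    1 / 16 * (2 * xi + s) * (2 * eta + t)
      * (- s * t + 2 * s * eta + 2 * t * xi + 12 * xi * eta)) 0.
Proof.
move=> s2 t2.
apply: (eq_cell_mean (cell_meanD
  (cell_mean_quad (- 1 / 16) 0 (1 / 4) 1 (2 * t) 0)
  (cell_mean_quad (1 / 16) (s / 2) (3 / 4) 0 (2 * t) 4))) => [x y|].
  rewrite /quad.
  have eqs : s * s = 1 by rewrite -expr2.
  have eqt : t * t = 1 by rewrite -expr2.
  by field: eqs eqt; rewrite dx_neq0 dy_neq0.
by field.
Qed.

Lemma cell_mean_B_pp : cell_mean (B_pp dx dy) 0.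
Proof.
apply: (eq_cell_mean (@cell_mean_B_node 1 1 _ _)) => [||x y|]//; try ring.
by rewrite /B_pp/=; ring.
Qed.

Lemma cell_mean_B_mp : cell_mean (B_mp dx dy) 0.
Proof.
apply: (eq_cell_mean (@cell_mean_B_node (- 1) 1 _ _)) => [||x y|]//; try ring.
by rewrite /B_mp/=; ring.
Qed.

Lemma cell_mean_B_mm : cell_mean (B_mm dx dy) 0.
Proof.
apply: (eq_cell_mean (@cell_mean_B_node (- 1) (- 1) _ _))
  => [||x y|]//; try ring.
by rewrite /B_mm/=; ring.
Qed.

Lemma cell_mean_B_pm : cell_mean (B_pm dx dy) 0.
Proof.
apply: (eq_cell_mean (@cell_mean_B_node 1 (- 1) _ _)) => [||x y|]//; try ring.
by rewrite /B_pm/=; ring.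
Qed.

End CellMean.

(** * The cells of a uniform grid *)

Section UniformGrid.
Context {R : realType} {h : R} {xh : int -> R}.
Hypotheses (h_gt0 : 0 < h) (grid : uniform_grid h xh).

Lemma uniform_gridE (i : int) : xh i = xh 0 + h * i%:~R.
Proof.
elim: i => [|n IHn|n IHn]; first by rewrite mulr0 addr0.
- have /eqP := grid n.+1; rewrite subr_eq => /eqP ->.
  by rewrite (_ : n.+1%:Z - 1 = n) ?IHn ?intS ?intrD; [ring|lia].
- have := grid (- n%:Z); rewrite (_ : - n%:Z - 1 = - n.+1%:Z); last by lia.
  by rewrite IHn intS !mulrNz intrD => e; lra.
Qed.

Lemma midpoint_subhalf (i : int) : midpoint xh i - h / 2 = xh (i - 1).
Proof. by rewrite /midpoint -(grid i); field. Qed.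

Lemma midpoint_addhalf (i : int) : midpoint xh i + h / 2 = xh i.
Proof. by rewrite /midpoint -(grid i); field. Qed.

(** The half-open intervals of the grid are pairwise disjoint. *)
Lemma interval_index_unique (i k : int) (x : R) :
  x \in `[xh (i - 1), xh i[%R -> x \in `[xh (k - 1), xh k[%R -> i = k.
Proof.
have half (p q : int) :
    x \in `[xh (p - 1), xh p[%R -> x \in `[xh (q - 1), xh q[%R -> p <= q.
  rewrite !in_itv/= => /andP[px _] /andP[_ xq].
  have := le_lt_trans px xq.
  rewrite (uniform_gridE (p - 1)) (uniform_gridE q).
  by rewrite ltrD2l ltr_pM2l// ltr_int; lia.
by move=> xi xk; apply/eqP; rewrite eq_le !half.
Qed.

End UniformGrid.

(** * Pairing with the test function of a cell *)

Section Pairing.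
Context {R : realType} {dx dy : R} {xh yh : int -> R}.
Hypotheses (dx_gt0 : 0 < dx) (dy_gt0 : 0 < dy).
Hypotheses (grid_x : uniform_grid dx xh) (grid_y : uniform_grid dy yh).
Local Notation mu := (@lebesgue_measure R).
Local Notation mu2 := (mu \x mu)%E.
Local Notation "''1_C' ( i , j )" := (\1_(cell xh yh i j) : R * R -> R).

Lemma cell_eq_box (i j : int) : cell xh yh i j =
  `[midpoint xh i - dx / 2, midpoint xh i + dx / 2[%classic `*`
  `[midpoint yh j - dy / 2, midpoint yh j + dy / 2[%classic.
Proof.
by rewrite (midpoint_subhalf grid_x) (midpoint_subhalf grid_y)
  (midpoint_addhalf grid_x) (midpoint_addhalf grid_y).
Qed.

Lemma measurable_cell (i j : int) :
  measurable (cell xh yh i j : set (measurableTypeR R * measurableTypeR R)).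
Proof. exact: measurableX. Qed.

Lemma indic_cellM (i j k l : int) (z : R * R) :
  '1_C(i, j) z * '1_C(k, l) z = ((i == k)%:R * (j == l)%:R) * '1_C(i, j) z.
Proof.
rewrite !indicE.
have [/set_mem[/= xi yj]|_] := boolP (z \in cell xh yh i j); last first.
  by rewrite mul0r mulr0.
rewrite mul1r mulr1.
have [/set_mem[/= xk yl]|zkl] := boolP (z \in cell xh yh k l).
  rewrite (interval_index_unique dx_gt0 grid_x xi xk).
  by rewrite (interval_index_unique dy_gt0 grid_y yj yl) !eqxx mulr1.
have [ik|] := eqVneq i k; last by rewrite mul0r.
have [jl|] := eqVneq j l; last by rewrite mulr0.
by case/negP: zkl; rewrite -ik -jl; apply/mem_set.
Qed.

(** The test function psi_ij times [v] is integrable over the plane and its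
integral is [r].  Integrability is included because it is what makes the
relation additive in [v] ([pairingD]). *)
Definition pairing (i j : int) (v : R -> R -> R) (r : R) : Prop :=
  mu2.-integrable setT
    (fun z => (psi_avg dx dy xh yh i j z.1 z.2 * v z.1 z.2)%:E) /\
  L2_inner (psi_avg dx dy xh yh i j) v = r%:E.

Lemma pairingD (i j : int) (v1 v2 : R -> R -> R) (r1 r2 : R) :
  pairing i j v1 r1 -> pairing i j v2 r2 ->
  pairing i j (fun x y => v1 x y + v2 x y) (r1 + r2).
Proof.
move=> [int1 e1] [int2 e2].
have psiD : (fun z : R * R => (psi_avg dx dy xh yh i j z.1 z.2 *
      (v1 z.1 z.2 + v2 z.1 z.2))%:E) =
    ((fun z => (psi_avg dx dy xh yh i j z.1 z.2 * v1 z.1 z.2)%:E) \+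
     (fun z => (psi_avg dx dy xh yh i j z.1 z.2 * v2 z.1 z.2)%:E))%E.
  by apply/funext => z; rewrite mulrDr EFinD.
split; first by rewrite psiD; exact: integrableD.
rewrite /L2_inner psiD integralD//.
by rewrite EFinD -e1 -e2.
Qed.

(** A local polynomial of mean [v] placed on the cell C_kl pairs with psi_ij to
[v] when the two cells coincide and to 0 otherwise. *)
Lemma pairing_local (B : R -> R -> R) (v : R) (i j k l : int) :
  cell_mean dx dy B v ->
  pairing i j
    (fun x y => B (x - midpoint xh k) (y - midpoint yh l) * '1_C(k, l) (x, y))
    (v * ((i == k)%:R * (j == l)%:R)).
Proof.
move=> /(_ (midpoint xh k) (midpoint yh l)); rewrite -cell_eq_box => -[intB eB].
pose c : R := (dx * dy)^-1 * ((i == k)%:R * (j == l)%:R).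
have psiB : (fun z : R * R => (psi_avg dx dy xh yh i j z.1 z.2 *
      (B (z.1 - midpoint xh k) (z.2 - midpoint yh l)
         * '1_C(k, l) (z.1, z.2)))%:E) =
    (fun z => (c%:E * ((fun z => (B (z.1 - midpoint xh k)
       (z.2 - midpoint yh l))%:E) \_ (cell xh yh k l)) z)%E).
  apply/funext => -[x y] /=; rewrite /psi_avg.
  transitivity (((dx * dy)^-1 * ('1_C(k, l) (x, y) * '1_C(i, j) (x, y)) *
    B (x - midpoint xh k) (y - midpoint yh l))%:E).
    by congr EFin; ring.
  rewrite indic_cellM (eq_sym k) (eq_sym l) indicE /patch /c.
  case: (_ \in _); last by rewrite mulr0 mulr0 mul0r mule0.
  by rewrite -EFinM mulr1.
have intB' := (integrable_mkcond _ (measurable_cell k l)).1 intB.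
split; first by rewrite psiB; exact: integrableZl.
rewrite /L2_inner psiB integralZl// -integral_mkcond eB -EFinM /c.
by congr EFin; field; rewrite !gt_eqF.
Qed.

End Pairing.

Theorem theorem3p1 (R : realType) (dx dy : R) (xh yh : int -> R)
    (dx_gt0 : 0 < dx) (dy_gt0 : 0 < dy)
    (grid_x : uniform_grid dx xh) (grid_y : uniform_grid dy yh) :
  forall i j i' j' : int,
    [/\ L2_inner (psi_avg dx dy xh yh i j) (phi_avg dx dy xh yh i' j')
          = ((i == i')%:R * (j == j')%:R)%:E,
        L2_inner (psi_avg dx dy xh yh i j) (phi_xedge dx dy xh yh i' j')
          = 0%:E,
        L2_inner (psi_avg dx dy xh yh i j) (phi_yedge dx dy xh yh i' j')
          = 0%:E
      & L2_inner (psi_avg dx dy xh yh i j) (phi_node dx dy xh yh i' j')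
          = 0%:E].
Proof.
move=> i j i' j'.
have local B v k l :=
  @pairing_local _ _ _ _ _ dx_gt0 dy_gt0 grid_x grid_y B v i j k l.
have local0 B k l (mean : cell_mean dx dy B 0) := local B 0 k l mean.
split.
- have [_] := local _ _ i' j' (cell_mean_B_00 dx_gt0 dy_gt0).
  by rewrite mul1r.
- have [_] := pairingD (local0 _ i' j' (cell_mean_B_p0 dx_gt0 dy_gt0))
    (local0 _ (i' + 1) j' (cell_mean_B_m0 dx_gt0 dy_gt0)).
  by rewrite !mul0r !addr0.
- have [_] := pairingD (local0 _ i' j' (cell_mean_B_0p dx_gt0 dy_gt0))
    (local0 _ i' (j' + 1) (cell_mean_B_0m dx_gt0 dy_gt0)).
  by rewrite !mul0r !addr0.
- have [_] := pairingD (pairingD (pairingD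
    (local0 _ i' j' (cell_mean_B_pp dx_gt0 dy_gt0))
    (local0 _ i' (j' + 1) (cell_mean_B_pm dx_gt0 dy_gt0)))
    (local0 _ (i' + 1) j' (cell_mean_B_mp dx_gt0 dy_gt0)))
    (local0 _ (i' + 1) (j' + 1) (cell_mean_B_mm dx_gt0 dy_gt0)).
  by rewrite !mul0r !addr0.
Qed.
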